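(* Under the standing assumptions, let $T_i=P_i$ be projectors onto nonempty, closed and convex sets $C_i\subset\mathcal{H}$, $i\in I$. Then the regularity condition $$\operatorname{dist}^2(x,C)\le\kappa R(x)\qquad\forall x\in\mathcal{H}$$ is satisfied with $\kappa>0$ if and only if $$R(x)\le\frac{\kappa}{4}\|\nabla R(x)\|^2\qquad\forall x\in\mathcal{H},$$ i.e. $R$ has the global KL (Kurdyka–Łojasiewicz) property.
   Context: Setting: $\mathcal{H}$ is a Hilbert space with norm $\|\cdot\|$ and Borel $\sigma$-algebra $\mathcal{B}(\mathcal{H})$; $I$ is an arbitrary index set and $(I,\mathcal{I})$ is a measurable space; $(T_i)_{i\in I}$ is a family of continuous maps $T_i:\mathcal{H}\to\mathcal{H}$. $(\Omega,\mathcal{F},\mathbb{P})$ is a probability space, $\xi:\Omega\to I$ is a random variable, and $(\xi_k)$ is an i.i.d. sequence of copies of $\xi$. $X_0$ is an $\mathcal{H}$-valued random variable with law $\mu$ (the initial point of the random function iteration $X_{k+1}=T_{\xi_k}X_k$). $\operatorname{Fix}T_i=\{x\in\mathcal{H}: T_ix=x\}$, so that $\operatorname{Fix}P_i=C_i$, where $P_i$ is the metric projector onto $C_i$. Put $C:=\{x\in\mathcal{H}:\mathbb{P}(x\in\operatorname{Fix}T_\xi)=1\}$. Standing assumptions: (1a) $X_0,\xi_0,\xi_1,\dots,\xi_k$ are independent for every $k$, with $(\xi_k)$ i.i.d.; (1b) the map $\Phi:\mathcal{H}\times I\to\mathcal{H}$, $\Phi(x,i)=T_ix$, is measurable; (2)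 $C\neq\emptyset$. Notation: $R(x):=\mathbb{E}[\|x-T_\xi x\|^2]$ and $\operatorname{dist}(x,C)=\inf_{c\in C}\|x-c\|$. For projectors as in the claim, $R$ is real-valued, convex and continuously differentiable, and $\nabla R$ denotes its (Fréchet) gradient. Global KL property: a convex, continuously differentiable function $f:\mathcal{H}\to\mathbb{R}$ with $\inf_x f(x)=0$ and $S:=\operatorname{argmin}f\neq\emptyset$ is said to have the global KL property if there exists a concave continuously differentiable function $\varphi:\mathbb{R}_+\to\mathbb{R}_+$ (with $\mathbb{R}_+=[0,\infty)$) with $\varphi(0)=0$ and $\varphi'>0$ such that $\varphi'(f(x))\,\|\nabla f(x)\|\ge1$ for all $x\in\mathcal{H}\setminus S$.
   Formalization: In the KL property φ is only continuous at 0 and C¹ on (0,∞), since C¹ at 0 fails already for R(x)=x²; the ''i.e.'' is proved as equivalence with KL for φ(s)=√(κs), plus the implication to KL with some φ, because KL with arbitrary φ does not imply the regularity condition. *)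

(* Defs.v *)
From HB Require Import structures.
From mathcomp Require Import all_boot all_order all_algebra.
From mathcomp Require Import sesquilinear.
From mathcomp Require Import all_classical all_reals all_analysis.

Set Implicit Arguments.
Unset Strict Implicit.
Unset Printing Implicit Defensive.

Import Order.TTheory GRing.Theory Num.Theory.
Import numFieldNormedType.Exports.

Local Open Scope classical_set_scope.
Local Open Scope ring_scope.

(* A real Hilbert space is a complete normed module [H] over a [realType],
   together with a positive definite symmetric form inducing its norm. *)
Definition induces_norm (R : realType) (H : completeNormedModType R)
    (ip : {dot H for (@idfun R)}) : Prop :=
  forall x : H, `|x| ^+ 2 = ip x x.

Definition borel (R : realType) (H : completeNormedModType R) :=
  g_sigma_algebraType (@open H).

Definition Fix (X : Type) (f : X -> X) : set X := [set x | f x = x].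

Section hilbert.
Context {R : realType} {H : completeNormedModType R}.
Implicit Types (x : H) (A : set H) (f : H -> R).

Definition dist x A : R := inf [set `|x - a| | a in A].

Definition is_projector A (p : H -> H) : Prop :=
  forall x, A (p x) /\ `|x - p x| = dist x A.

Definition argmin f : set H := [set x | forall y, f x <= f y].

Definition is_gradient (ip : {dot H for (@idfun R)}) f x (g : H) : Prop :=
  differentiable (f : H -> R^o) x /\
  forall h, 'd (f : H -> R^o) x h = ip g h.

(* There is at most one gradient at a point; the value is 0 if there is none. *)
Definition gradient (ip : {dot H for (@idfun R)}) f x : H :=
  xget 0 [set g | is_gradient ip f x g].

Definition continuously_differentiable (ip : {dot H for (@idfun R)}) f : Prop :=
  (forall x, differentiable (f : H -> R^o) x) /\ continuous (gradient ip f).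

(* The derivative of [phi] only matters at the values of [f] outside [argmin f],
   which are positive. As usual for desingularizing functions, [phi] is C^1 on
   ]0, +oo[ and merely continuous at 0: the slope at 0 may be infinite, as it is
   for square roots. A finite slope at 0 would bound the norm of the gradient
   away from 0 outside [argmin f]. *)
Definition desingularizing (phi : R -> R) : Prop :=
  [/\ forall s, 0 <= s -> 0 <= phi s,
      phi 0 = 0,
      convex_function (`[0, +oo[%classic : set (convex_lmodType R^o))
        (fun s => - phi s),
      {within `[0, +oo[, continuous phi} &
      forall s, 0 < s ->
        [/\ derivable (phi : R -> R^o) s 1,
            {for s, continuous (derive1 (phi : R -> R^o))} &
            0 < derive1 (phi : R -> R^o) s]].

Definition global_KL_with (ip : {dot H for (@idfun R)}) f (phi : R -> R) : Prop :=
  [/\ convex_function [set: convex_lmodType H] f,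
      continuously_differentiable ip f,
      inf (range f) = 0 /\ argmin f !=set0,
      desingularizing phi &
      forall x, ~ argmin f x ->
        1 <= derive1 (phi : R -> R^o) (f x) * `|gradient ip f x|].

Definition global_KL (ip : {dot H for (@idfun R)}) f : Prop :=
  exists phi : R -> R, global_KL_with ip f phi.

End hilbert.

Section random_functions.
Context {R : realType} {H : completeNormedModType R}.
Context {dO dI : measure_display} {Omega : measurableType dO}
  {I : measurableType dI} (P : probability Omega R).

Definition identically_distributed (X Y : {RV P >-> I}) : Prop :=
  forall B : set I, measurable B -> distribution P X B = distribution P Y B.

(* Mutual independence of X0, xi_ 0, ..., xi_ k for every k; taking some of the
   sets to be full gives the product rule for subfamilies. *)
Definition independent_sequence (X0 : {RV P >-> borel H})
    (xi_ : nat -> {RV P >-> I}) : Prop :=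
  forall (k : nat) (A : set (borel H)) (B : nat -> set I),
    measurable A -> (forall j, measurable (B j)) ->
    (P (X0 @^-1` A `&` \bigcap_(j < k.+1) (xi_ j @^-1` B j)) =
     P (X0 @^-1` A) * \prod_(j < k.+1) P (xi_ j @^-1` B j))%E.

Definition common_fixpoints (T : I -> H -> H) (xi : {RV P >-> I}) : set H :=
  [set x | P [set w | Fix (T (xi w)) x] = 1%E].

(* For projectors with a common fixed point c, the expectation is at most
   `|x - c| ^+ 2, so [fine] loses nothing. *)
Definition residual (T : I -> H -> H) (xi : {RV P >-> I}) (x : H) : R :=
  fine 'E_P[(fun w => `|x - T (xi w) x| ^+ 2)%R]%E.

End random_functions.

(* Main.v *)
(* Let [G x] be twice the mean of [x - T (xi w) x]. For a projector [p] onto a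
   convex set, with [q x = x - p x],
     |q x|^2 + 2 <q x, h> <= |q (x + h)|^2 <= |q x|^2 + 2 <q x, h> + |h|^2,
   so the residual [Res] satisfies the same sandwich with the linear term
   [<G x, h>]: it is convex and differentiable, with gradient [G], which is
   2-Lipschitz because [q] is nonexpansive.
   If the regularity condition holds, integrate |q x|^2 <= <q x, x - c> for [c]
   in [C] to get 2 Res x <= |G x| |x - c|, hence 2 Res x <= |G x| dist x C.
   Conversely, along the gradient descent [x - t G x] with [0 < t < 1], the
   gradient inequality makes the square root of [Res] decrease by at least
   (1 - t) / sqrt kappa times the length of the step. Hence the iteration
   converges to a zero of [Res] within sqrt kappa / (1 - t) * sqrt (Res x) of
   its starting point [x], and [t] tends to 0. *)

Require Import Defs.
From HB Require Import structures.
From mathcomp Require Import all_boot all_order all_algebra.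
From mathcomp Require Import sesquilinear.
From mathcomp Require Import all_classical all_reals all_analysis.
From mathcomp Require Import measurable_realfun ring lra.

Set Implicit Arguments.
Unset Strict Implicit.
Unset Printing Implicit Defensive.

Import Order.TTheory GRing.Theory Num.Theory.
Import numFieldNormedType.Exports.

Local Open Scope classical_set_scope.
Local Open Scope ring_scope.

(** * Cauchy sequences, Lipschitz maps and a small-parameter argument *)

Lemma cvgn_dominated {R : realType} {V : completeNormedModType R}
    (u : V^nat) (e : R^nat) :
  (forall n m, (n <= m)%N -> `|u n - u m| <= e n) -> e @ \oo --> 0 ->
  cvgn u.
Proof.
move=> ue e0; apply/cauchy_cvgP/cauchy_exP => _/posnumP[d].
have [n /= _ en] : \forall n \near \oo, `|0 - e n| < d%:num.
  by move/cvgrPdist_lt : e0; apply.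
exists (u n); exists n => // m /= nm; rewrite -ball_normE /=.
apply: le_lt_trans (ue _ _ nm) (le_lt_trans (ler_norm _) _).
by have := en n (leqnn n); rewrite sub0r normrN.
Qed.

Lemma lipschitz_continuous {R : realType} {V W : normedModType R}
    (f : V -> W) (k : R) :
  (forall x y, `|f x - f y| <= k * `|x - y|) -> continuous f.
Proof.
move=> fk x; apply/cvgrPdist_lt => e e0; near=> y.
apply: le_lt_trans (fk x y) _.
(* The sign of [k] is unknown, so a positive constant replaces it before dividing. *)
apply: (@le_lt_trans _ _ ((`|k| + 1) * `|x - y|)).
  by rewrite ler_wpM2r// (le_trans (ler_norm k))// lerDl.
have k0 : 0 < `|k| + 1 by rewrite ltr_wpDl.
rewrite -ltr_pdivlMl//; near: y.
by apply: cvgr_dist_lt; [exact: cvg_id|rewrite mulr_gt0 ?invr_gt0].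
Unshelve. all: by end_near. Qed.

(** Divide by [t] and let [t] tend to 0. This extracts first-order conditions from minimality and
    removes error terms of order [t]. *)
Lemma le0_of_quadratic {R : realType} (a b : R) :
  (forall t, 0 < t <= 1 -> a * t <= b * t ^+ 2) -> a <= 0.
Proof.
move=> ab; rewrite leNgt; apply/negP => a0.
have b0 := normr_ge0 b; have bb := ler_norm b.
have d0 : 0 < 2 * (`|b| + a) by lra.
(* This choice gives [b * t <= a / 2], against [a <= b * t]. *)
set t := a / (2 * (`|b| + a)).
have tE : t * (2 * (`|b| + a)) = a by rewrite /t divfK ?gt_eqF.
have t0 : 0 < t by rewrite divr_gt0.
have t1 : t <= 1 by rewrite /t ler_pdivrMr//; lra.
clearbody t; have := ab t; rewrite t0 t1 => /(_ isT).
rewrite expr2 mulrA ler_pM2r// => abt.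
by nra.
Qed.

(** * Inner products and the Riesz representation *)

Section hilbert_space.
Context {R : realType} {H : completeNormedModType R}
  (ip : {dot H for (@idfun R)}) (ip_norm : induces_norm ip).
Implicit Types (x y h : H) (A : set H) (f : H -> R) (G : H -> H).

Lemma ipC x y : ip x y = ip y x.
Proof. by rewrite hermC expr0 mul1r. Qed.

Lemma ipZl a x y : ip (a *: x) y = a * ip x y.
Proof. exact: linearZl_LR. Qed.

Lemma ipZr a x y : ip x (a *: y) = a * ip x y.
Proof. by rewrite ipC ipZl ipC. Qed.

Lemma normrD_sqr x y : `|x + y| ^+ 2 = `|x| ^+ 2 + 2 * ip x y + `|y| ^+ 2.
Proof. rewrite !ip_norm linearDl /= !linearDr /= (ipC y x); ring. Qed.

Lemma normrB_sqr x y : `|x - y| ^+ 2 = `|x| ^+ 2 - 2 * ip x y + `|y| ^+ 2.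
Proof. by rewrite normrD_sqr normrN linearNr mulrN. Qed.

(** Cauchy-Schwarz comes from squaring the triangle inequality, which the normed module [H] already
    has. *)
Lemma ip_le x y : ip x y <= `|x| * `|y|.
Proof.
have : `|x + y| ^+ 2 <= (`|x| + `|y|) ^+ 2.
  by rewrite ler_sqr ?nnegrE ?addr_ge0// ler_normD.
by rewrite normrD_sqr sqrrD -mulr_natl; lra.
Qed.

Lemma normr_ip_le x y : `|ip x y| <= `|x| * `|y|.
Proof.
rewrite ler_norml ip_le andbT lerNl -linearNl.
by apply: le_trans (ip_le _ _) _; rewrite normrN.
Qed.

Lemma ip_inj x y : (forall h, ip x h = ip y h) -> x = y.
Proof.
move=> xy; apply/eqP; rewrite -subr_eq0 -normr_eq0 -sqrf_eq0 ip_norm.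
by rewrite linearBl /= xy subrr.
Qed.

Lemma ipDl x y z : ip (x + y) z = ip x z + ip y z.
Proof. exact: linearDl. Qed.

Lemma ipNl x y : ip (- x) y = - ip x y.
Proof. exact: linearNl. Qed.

Lemma ipDr x y z : ip x (y + z) = ip x y + ip x z.
Proof. exact: linearDr. Qed.

Lemma ipNr x y : ip x (- y) = - ip x y.
Proof. exact: linearNr. Qed.

(** Pairing with an arbitrary vector turns an identity in [H] into a scalar one for [ring]. *)
Local Ltac by_ip := apply: ip_inj => ?; rewrite !(ipDl, ipNl, ipZl); ring.

Lemma normr_le_ip x (M : R) :
  0 <= M -> (forall h, ip x h <= M * `|h|) -> `|x| <= M.
Proof.
move=> M0 xM; have [->|x0] := eqVneq x 0; first by rewrite normr0.
by have := xM x; rewrite -ip_norm expr2 ler_pM2r// normr_gt0.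
Qed.

Lemma continuous_ipl h : continuous (ip^~ h : H -> R^o).
Proof.
apply: (@lipschitz_continuous _ _ _ _ `|h|) => x y.
by rewrite -linearBl mulrC; exact: normr_ip_le.
Qed.

(* The representing vector minimizes [`|h| ^+ 2 - 2 * L h]; by the parallelogram
   law every minimizing sequence is Cauchy. *)
Lemma riesz_representation (L : H -> R) (M : R) :
  {morph L : x y / x + y} -> (forall a, {morph L : x / a *: x >-> a * x}) ->
  (forall h, `|L h| <= M * `|h|) -> exists g, forall h, L h = ip g h.
Proof.
move=> LD LZ LM; pose J h := `|h| ^+ 2 - 2 * L h.
have Jlb : has_lbound (range J).
  (* Completing the square in |h| - M gives this bound. *)
  exists (- M ^+ 2) => _ [h _ <-]; rewrite /J.
  by have := ler_norm (L h); have := LM h; have := sqr_ge0 (`|h| - M); nra.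
have Jinf h : inf (range J) <= J h by apply: ge_inf => //; exists h.
(* The slack is squared so that distances, after a square root, are of order [harmonic n]. *)
have /choice[x xJ] n : exists h, J h < inf (range J) + harmonic n ^+ 2.
  have [||_ [h _ <-] hn] := @inf_adherent R (range J) (harmonic n ^+ 2).
  - by rewrite exprn_gt0// /harmonic invr_gt0.
  - by split => //; exists (J 0), 0.
  - by exists h.
have parallelogram a b :
    `|a - b| ^+ 2 = 2 * (J a + J b - 2 * J (2^-1 *: (a + b))).
  rewrite /J LZ LD normrZ exprMn normrB_sqr normrD_sqr ger0_norm//; lra.
have xcauchy n m : (n <= m)%N -> `|x n - x m| <= 2 * harmonic n.
  move=> nm; rewrite -ler_sqr ?nnegrE ?mulr_ge0// ?harmonic_ge0//.
  have hmn : harmonic m ^+ 2 <= harmonic n ^+ 2 :> R.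
    rewrite ler_sqr ?nnegrE ?harmonic_ge0// /harmonic lef_pV2 ?posrE//.
    by rewrite ler_nat ltnS.
  rewrite parallelogram exprMn.
  have := xJ n; have := xJ m; have := Jinf (2^-1 *: (x n + x m)); lra.
have /cvg_ex[/= g xg] : cvgn x.
  apply: (cvgn_dominated xcauchy); rewrite -[0](mulr0 2).
  by apply: cvgM; [exact: cvg_cst|exact: cvg_harmonic].
have Lc : continuous (L : H -> R^o).
  apply: (@lipschitz_continuous _ _ _ _ M) => a b.
  by have -> : L a - L b = L (a - b) by rewrite LD -(scaleN1r b) LZ mulN1r.
have Jg : J g <= inf (range J).
  have Jx : J (x n) @[n --> \oo] --> J g.
    apply: cvgB; first by apply: cvgM; exact: cvg_norm xg.
    by apply: cvgM; [exact: cvg_cst|apply: continuous_cvg => //; exact: Lc].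
  have e0 : inf (range J) + harmonic n ^+ 2 @[n --> \oo] --> inf (range J).
    rewrite -[X in _ --> X]addr0 -[X in _ + X](mulr0 0).
    by apply: cvgD; [exact: cvg_cst|apply: cvgM; exact: cvg_harmonic].
  by apply: (ler_cvg_to Jx e0); apply: nearW => n; exact: ltW.
(* Compare [J] at [g] and at [g + t *: h]; using [h] and [- h] then gives equality. *)
have Lle h : 2 * (L h - ip g h) <= 0.
  apply: (@le0_of_quadratic _ _ (`|h| ^+ 2)) => t _.
  have := le_trans Jg (Jinf (g + t *: h)).
  rewrite /J normrD_sqr LD LZ ipZr normrZ exprMn real_normK ?num_real//; lra.
exists g => h; apply/eqP; rewrite eq_le; apply/andP; split.
  by have := Lle h; lra.
have := Lle (- h); rewrite -scaleN1r LZ ipZr; lra.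
Qed.

(** * Projectors onto convex sets *)

Lemma dist_le x A a : A a -> dist x A <= `|x - a|.
Proof.
move=> Aa; apply: ge_inf; last by exists a.
by exists 0 => _ [b _ <-].
Qed.

Lemma dist_ge0 x A : 0 <= dist x A.
Proof.
(* For empty [A] the distance is 0, the default value of [inf]. *)
have [->|/set0P[a Aa]] := eqVneq A set0.
  by rewrite /dist image_set0 inf0.
by apply: lb_le_inf; [exists `|x - a|, a|move=> _ [b _ <-]].
Qed.

Lemma le_dist x A (r : R) :
  A !=set0 -> (forall a, A a -> r <= `|x - a|) -> r <= dist x A.
Proof.
move=> [a Aa] rA; apply: lb_le_inf; first by exists `|x - a|, a.
by move=> _ [b Ab <-]; exact: rA.
Qed.

Section projector.
Context (A : set H) (p : H -> H).
Hypothesis Aconv : convex_set (A : set (convex_lmodType H)).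
Hypothesis Ap : is_projector A p.

(** The segment from [p x] to [a] stays in [A], and none of its points is closer to [x] than [p x];
    the first-order term along it gives the sign. *)
Lemma projector_obtuse x a : A a -> ip (x - p x) (a - p x) <= 0.
Proof.
move=> Aa; have [Apx xpx] := Ap x.
suff : 2 * ip (x - p x) (a - p x) <= 0 by lra.
apply: (@le0_of_quadratic _ _ (`|a - p x| ^+ 2)) => t /andP[t0 t1].
have Aq : A (p x + t *: (a - p x)).
  have /set_mem := Aconv (Itv01 (ltW t0) t1) (mem_set Aa) (mem_set Apx).
  congr A.
  rewrite [LHS](_ : _ = t *: a + (1 - t) *: p x)//; by_ip.
have := dist_le x Aq; rewrite -xpx -ler_sqr ?nnegrE//.
rewrite opprD addrA (normrB_sqr (x - p x)) ipZr normrZ exprMn.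
by rewrite real_normK ?num_real//; lra.
Qed.

Lemma projector_mono x y : 0 <= ip (x - p x) (p x - p y).
Proof.
have := projector_obtuse x (Ap y).1.
by rewrite !(ipDr, ipNr); lra.
Qed.

(** Write x - y as the difference of the residuals plus p x - p y: the cross term is nonnegative by
    [projector_mono] used in both directions. *)
Lemma projector_res_lip x y : `|(x - p x) - (y - p y)| <= `|x - y|.
Proof.
rewrite -ler_sqr ?nnegrE//.
have -> : x - y = (x - p x - (y - p y)) + (p x - p y).
  by by_ip.
rewrite [leRHS]normrD_sqr (ipDl (x - p x)) ipNl.
have := projector_mono x y; have := projector_mono y x.
rewrite !(ipDr (y - p y), ipDr (x - p x), ipNr).
by have := sqr_ge0 `|p x - p y|; lra.
Qed.

(** Expand the square of (x - p x) + v, with v the difference of the residuals; by [projector_mono],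
    passing from v to y - x can only lower the linear term. *)
Lemma projector_sqr_ge x y :
  `|x - p x| ^+ 2 + 2 * ip (x - p x) (y - x) <= `|y - p y| ^+ 2.
Proof.
have -> : y - x = (y - p y - (x - p x)) - (p x - p y).
  by by_ip.
set v := y - p y - (x - p x).
have -> : y - p y = (x - p x) + v by rewrite /v [RHS]addrC subrK.
rewrite [leRHS]normrD_sqr ipDr ipNr.
by have := projector_mono x y; have := sqr_ge0 `|v|; lra.
Qed.

(** The point [p x] of [A] competes in the distance from [y], so |y - p y| <= |y - p x|. *)
Lemma projector_sqr_le x y :
  `|y - p y| ^+ 2 <= `|x - p x| ^+ 2 + 2 * ip (x - p x) (y - x) + `|y - x| ^+ 2.
Proof.
rewrite -normrD_sqr ler_sqr ?nnegrE// (Ap y).2.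
have -> : x - p x + (y - x) = y - p x by by_ip.
exact/dist_le/(Ap x).1.
Qed.

End projector.

(** * Error bound by gradient descent *)

Section descent.
Context (f : H -> R) (G : H -> H) (kappa : R).
Hypothesis f_ge0 : forall x, 0 <= f x.
Hypothesis f_smooth : forall x h, f (x + h) <= f x + ip (G x) h + `|h| ^+ 2.
Hypothesis G_continuous : continuous G.
Hypothesis kappa_gt0 : 0 < kappa.
Hypothesis f_grad : forall x, f x <= kappa / 4 * `|G x| ^+ 2.

Let step (t : R) x := x - t *: G x.
Let kappa_ge0 := ltW kappa_gt0.

(** Smoothness gives a decrease of [f] by at least t (1 - t) |G x|^2. Factor this decrease as (a -
    b) (a + b) with a, b the square roots of the values; [f_grad] gives a + b <= 2 a <= sqrt kappa
    |G x|, and one factor |G x| cancels. *)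
Lemma descent_step t x : 0 < t < 1 ->
  (1 - t) * `|x - step t x| <=
  Num.sqrt kappa * (Num.sqrt (f x) - Num.sqrt (f (step t x))).
Proof.
move=> /andP[t0 t1].
have := f_smooth x (- (t *: G x)).
rewrite ipNr ipZr -ip_norm normrN normrZ exprMn real_normK ?num_real//.
rewrite -/(step t x).
have -> : x - step t x = t *: G x by rewrite /step opprB addrC subrK.
rewrite normrZ gtr0_norm//.
have := f_grad x; have := f_ge0 x; have := f_ge0 (step t x).
move: (f x) (f (step t x)) `|G x| (normr_ge0 (G x)) => a2 b2 N N0.
move=> b20 a20 aN ab.
have := sqr_sqrtr a20; have := sqr_sqrtr b20; have := sqr_sqrtr kappa_ge0.
move: (Num.sqrt kappa) (Num.sqrt a2) (Num.sqrt b2)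
  (sqrtr_ge0 kappa) (sqrtr_ge0 a2) (sqrtr_ge0 b2) => s a b s0 a0 b0 sE bE aE.
have aN2 : 2 * a <= s * N.
  rewrite -ler_sqr ?nnegrE ?mulr_ge0// !exprMn aE sE; lra.
have tN : t * (1 - t) * N ^+ 2 <= (a - b) * (a + b).
  by rewrite -subr_sqr aE bE; lra.
have ba : b <= a.
  rewrite -ler_sqr ?nnegrE// -subr_ge0 subr_sqr (le_trans _ tN)//.
  by rewrite !mulr_ge0 ?subr_ge0 ?sqr_ge0// ltW.
have [N00|Npos] := eqVneq N 0.
  by rewrite N00 !mulr0 mulr_ge0// subr_ge0.
have {}Npos : 0 < N by rewrite lt_def Npos.
rewrite -(ler_pM2r Npos).
have : (a - b) * (a + b) <= (a - b) * (s * N).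
  by rewrite ler_wpM2l ?subr_ge0//; lra.
by move: tN; rewrite expr2; lra.
Qed.

(** The step bounds telescope, so the iterates have finite total length and converge. The limit is
    fixed by [step t], so [G] vanishes there, and [f] too by [f_grad]. *)
Lemma descent_limit t x : 0 < t < 1 ->
  exists y, f y = 0 /\
    (1 - t) * `|x - y| <= Num.sqrt kappa * Num.sqrt (f x).
Proof.
move=> t01; have /andP[t0 t1] := t01.
pose u n := iter n (step t) x; pose a n := Num.sqrt (f (u n)).
have ua n m : (n <= m)%N ->
    (1 - t) * `|u n - u m| <= Num.sqrt kappa * (a n - a m).
  move=> /subnKC <-; elim: (m - n)%N => [|k IH].
    by rewrite addn0 !subrr normr0 !mulr0.
  rewrite addnS; have := descent_step (u (n + k)%N) t01.
  rewrite -[step t (u (n + k)%N)]/(u (n + k).+1) -/(a _) -/(a _.+1) => st.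
  have := ler_distD (u (n + k)%N) (u n) (u (n + k).+1).
  move/(ler_wpM2l (_ : 0 <= 1 - t)); rewrite subr_ge0 (ltW t1) => /(_ isT).
  by lra.
have t10 : 0 < 1 - t by rewrite subr_gt0.
have a_dec : nonincreasing_seq a.
  move=> n m /ua uanm; rewrite -subr_ge0 -(@pmulr_rge0 _ (Num.sqrt kappa)).
    by apply: le_trans uanm; rewrite mulr_ge0// ltW.
  by rewrite sqrtr_gt0.
have a_ge0 n : 0 <= a n by exact: sqrtr_ge0.
have acvg : cvgn a.
  by apply: nonincreasing_is_cvgn => //; exists 0 => _ [n _ <-].
have [y uy] : exists y, u n @[n --> \oo] --> y.
  apply/cvg_ex/(@cvgn_dominated _ _ _
    (fun n => (1 - t)^-1 * (Num.sqrt kappa * (a n - limn a)))) => [n m nm|].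
    rewrite ler_pdivlMl// (le_trans (ua n m nm))// ler_wpM2l ?sqrtr_ge0//.
    by rewrite lerD2l lerN2; exact: nonincreasing_cvgn_ge.
  rewrite -[X in _ --> X](mulr0 (1 - t)^-1) -(mulr0 (Num.sqrt kappa)).
  rewrite -(subrr (limn a)).
  apply: cvgM; first exact: cvg_cst.
  by apply: cvgM; [exact: cvg_cst|apply: cvgB => //; exact: cvg_cst].
have Gy : G y = 0.
  have : step t (u n) @[n --> \oo] --> step t y.
    apply: cvgB => //; apply: cvgZ; first exact: cvg_cst.
    by apply: continuous_cvg => //; exact: G_continuous.
  have : u n.+1 @[n --> \oo] --> y by rewrite cvg_shiftS.
  move=> u1 u2; have : step t y = y.
    exact: (@cvg_unique _ (@norm_hausdorff _ H) _ _ _ _ u2 u1).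
  move/eqP; rewrite /step -subr_eq0 addrAC subrr add0r oppr_eq0 scaler_eq0.
  by rewrite (gt_eqF t0) => /eqP.
exists y; split.
  apply/eqP; rewrite eq_le f_ge0 andbT (le_trans (f_grad _))//.
  by rewrite Gy normr0 expr0n mulr0.
have xu : (1 - t) * `|x - u n| @[n --> \oo] --> (1 - t) * `|x - y|.
  apply: cvgM; first exact: cvg_cst.
  by apply: cvg_norm; apply: cvgB => //; exact: cvg_cst.
have sc : (fun=> Num.sqrt kappa * a 0%N) @ \oo --> Num.sqrt kappa * a 0%N.
  exact: cvg_cst.
apply: (ler_cvg_to xu sc); apply: nearW => n.
apply: le_trans (ua 0%N n (leq0n n)) _.
by rewrite ler_wpM2l ?sqrtr_ge0// gerBl.
Qed.

(* Gradient descent with step [t] gives the bound up to a factor [1 - t]. *)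
Lemma error_bound x :
  dist x [set y | f y = 0] ^+ 2 <= kappa * f x.
Proof.
set D := dist _ _; rewrite -[leRHS]sqr_sqrtr ?mulr_ge0//.
rewrite ler_sqr ?nnegrE ?dist_ge0 ?sqrtr_ge0// sqrtrM// -subr_le0.
(* After division by [t] the condition reads (1 - t) D <= sqrt kappa * sqrt (f x). *)
apply: (@le0_of_quadratic _ _ D) => t /andP[t0 t1].
have B0 : 0 <= Num.sqrt kappa * Num.sqrt (f x) by rewrite mulr_ge0 ?sqrtr_ge0.
rewrite expr2 mulrA ler_pM2r//.
have [->|t1'] := eqVneq t 1; first by rewrite mulr1; lra.
have t01 : 0 < t < 1 by rewrite t0 lt_neqAle t1'.
have [y [fy0 xy]] := descent_limit x t01.
have : (1 - t) * D <= (1 - t) * `|x - y|.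
  by rewrite ler_wpM2l ?subr_ge0//; exact: dist_le.
lra.
Qed.

End descent.

(** * Gradients and convexity from a quadratic sandwich *)

Section quadratic_sandwich.
Context (f : H -> R) (G : H -> H).
Hypothesis f_ge : forall x h, f x + ip (G x) h <= f (x + h).
Hypothesis f_le : forall x h, f (x + h) <= f x + ip (G x) h + `|h| ^+ 2.

(** The remainder lies between 0 and |h|^2, hence is o(h). *)
Lemma is_gradient_sandwich x : is_gradient ip f x (G x).
Proof.
have dlin : linear (ip (G x) : H -> R^o).
  by move=> a u v; rewrite ipDr ipZr.
pose df : {linear H -> R^o} :=
  HB.pack (ip (G x) : H -> R^o) (GRing.isLinear.Build R H R^o *:%R _ dlin).
have dfc : continuous df.
  apply: (@lipschitz_continuous _ _ _ _ `|G x|) => u v.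
  by rewrite -linearB; exact: normr_ip_le.
have fdf : (f : H -> R^o) \o shift x = cst (f x) + df +o_ (0 : H) id.
  apply/eqaddoP => _/posnumP[e]; near=> h.
  rewrite /= -[X in `|X|]/(f (h + x) - (f x + ip (G x) h)).
  rewrite (addrC h) ger0_norm ?subr_ge0 ?f_ge//.
  apply: (@le_trans _ _ (`|h| ^+ 2)).
    by have := f_le x h; lra.
  by rewrite expr2 ler_wpM2r//; near: h; exact: nbhs0_le.
have dfE : 'd (f : H -> R^o) x = df :> (H -> R^o) by exact: diff_unique.
split; last by move=> h; rewrite dfE.
by apply/diff_locallyP; rewrite dfE.
Unshelve. all: by end_near. Qed.

Lemma gradient_sandwich x : gradient ip f x = G x.
Proof.
have [_ dG] := is_gradient_sandwich x.
rewrite /gradient; case: xgetP => [g _ [_ dg]|/(_ (G x))].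
  by apply: ip_inj => h; rewrite -dg dG.
by case; exact: is_gradient_sandwich.
Qed.

(** Average the lower bounds based at the convex combination [z]: their linear terms cancel. *)
Lemma convex_function_sandwich : convex_function [set: convex_lmodType H] f.
Proof.
move=> t x y _ _.
have [t0 t1] : 0 <= t%:num /\ t%:num <= 1 by split.
rewrite convRE (_ : conv t x y = (t%:num *: x + (1 - t%:num) *: y : H))//.
move: t%:num t0 t1 => {}t t0 t1.
set z := t *: x + (1 - t) *: y.
have fx := f_ge z (x - z); have fy := f_ge z (y - z).
rewrite !(addrC z) !subrK in fx fy.
have : t * ip (G z) (x - z) + (1 - t) * ip (G z) (y - z) = 0.
  rewrite -!ipZr -ipDr (_ : _ + _ = 0) ?linear0r//.
  by apply: ip_inj => h; rewrite /z !(ipDl, ipNl, ipZl) linear0l; ring.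
rewrite -subr_ge0 in t1.
have := ler_wpM2l t0 fx; have := ler_wpM2l t1 fy; rewrite /unstable.onem; lra.
Qed.

End quadratic_sandwich.

End hilbert_space.

(** * Square roots as desingularizing functions *)

Lemma derive1_sqrtM {R : realType} (k s : R) : 0 < k -> 0 < s ->
  derivable ((fun s : R => Num.sqrt (k * s)) : R -> R^o) s 1 /\
  derive1 ((fun s : R => Num.sqrt (k * s)) : R -> R^o) s =
    Num.sqrt k / (2 * Num.sqrt s).
Proof.
move=> k0 s0.
have -> : (fun s : R => Num.sqrt (k * s)) =
    (Num.sqrt k) \*: (@Num.sqrt R : R -> R^o).
  by apply/funext => r /=; rewrite sqrtrM ?ltW.
have ds := is_derive1_sqrt s0.
by split; [exact: derivableZ|rewrite derive1E deriveZ// derive_val].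
Qed.

(** For [k = kappa] the slope sqrt k / (2 sqrt s) makes the KL inequality the square root of the
    gradient inequality. *)
Lemma desingularizing_sqrt {R : realType} (k : R) : 0 < k ->
  desingularizing (fun s : R => Num.sqrt (k * s)).
Proof.
move=> k0; split.
- by move=> s _; exact: sqrtr_ge0.
- by rewrite mulr0 sqrtr0.
- move=> t x y; rewrite !inE/= !in_itv/= !andbT => x0 y0.
  have [t0 t1] : 0 <= t%:num /\ 0 <= 1 - t%:num by rewrite subr_ge0; split.
  rewrite -convN lerN2 !convRE.
  rewrite (_ : conv t x y = (t%:num * x + (1 - t%:num) * y : R))//.
  rewrite /unstable.onem.
  move: t%:num t0 t1 => {}t t0 t1.
  rewrite !(sqrtrM _ (ltW k0)).
  suff : t * Num.sqrt x + (1 - t) * Num.sqrt y <=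
      Num.sqrt (t * x + (1 - t) * y).
    by move/(ler_wpM2l (sqrtr_ge0 k)); lra.
  have := sqr_sqrtr x0; have := sqr_sqrtr y0.
  move: (Num.sqrt x) (Num.sqrt y) (sqrtr_ge0 x) (sqrtr_ge0 y).
  move=> a b a0 b0 <- <-.
  rewrite -[leLHS]ger0_norm -?sqrtr_sqr ?ler_wsqrtr//.
    by have := mulr_ge0 (mulr_ge0 t0 t1) (sqr_ge0 (a - b)); lra.
  by rewrite addr_ge0 ?mulr_ge0.
- apply: continuous_subspaceT => s.
  apply: continuous_comp; last exact: sqrt_continuous.
  by apply: cvgM; [exact: cvg_cst|exact: cvg_id].
- move=> s s0; have [ds dsE] := derive1_sqrtM k0 s0.
  split; [exact: ds| |by rewrite dsE divr_gt0// ?mulr_gt0 ?sqrtr_gt0].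
  suff : derive1 ((fun s : R => Num.sqrt (k * s)) : R -> R^o) r @[r --> s] -->
      Num.sqrt k / (2 * Num.sqrt s) by rewrite -dsE.
  have : Num.sqrt k / (2 * Num.sqrt r) @[r --> s] -->
      Num.sqrt k / (2 * Num.sqrt s).
    apply: cvgM; first exact: cvg_cst.
    apply: cvgV; first by rewrite mulf_neq0 ?gt_eqF ?sqrtr_gt0.
    by apply: cvgM; [exact: cvg_cst|exact: sqrt_continuous].
  (* The derivative formula is available at positive points only, which suffices near [s]. *)
  apply: cvg_trans; apply: near_eq_cvg; near=> r.
  by rewrite (derive1_sqrtM k0 _).2//; near: r; exact: lt_nbhsr.
Unshelve. all: by end_near. Qed.

(** * Residual of random projectors *)

Lemma measurable_continuous_borel {R : realType} {H : completeNormedModType R}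
    (F : H -> R) :
  continuous (F : H -> R^o) -> measurable_fun [set: borel H] F.
Proof.
move=> /continuousP cF; apply: (measurability _ (RGenOpens.measurableE R)).
move=> _ [_ [a [b ->] <-]]; rewrite setTI.
by apply: sub_sigma_algebra; apply: cF; exact: interval_open.
Qed.

Section random_projectors.
Context {R : realType} {H : completeNormedModType R}
  (ip : {dot H for (@idfun R)}) (ip_norm : induces_norm ip).
Context {dO dI : measure_display} {Omega : measurableType dO}
  {I : measurableType dI} (P : probability Omega R).
Context (xi : {RV P >-> I}) (T : I -> H -> H) (Ci : I -> set H).
Hypothesis Phi_measurable :
  measurable_fun [set: borel H * I] (fun z => T z.2 z.1 : borel H).
Hypothesis C_neq0 : common_fixpoints T xi !=set0.
Hypothesis Ci_convex : forall i, convex_set (Ci i : set (convex_lmodType H)).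
Hypothesis T_projector : forall i, is_projector (Ci i) (T i).

Let U x w := x - T (xi w) x.
Let integrable (f : Omega -> R) := P.-integrable [set: Omega] (EFin \o f).

Lemma measurable_fun_random_map (F : H -> R) x :
  continuous (F : H -> R^o) ->
  measurable_fun [set: Omega] (fun w => F (T (xi w) x)).
Proof.
move=> /measurable_continuous_borel mF.
have mT : measurable_fun [set: I] (fun i => T i x : borel H).
  exact: (measurableT_comp Phi_measurable (pair1_measurable (x : borel H))).
exact: (measurableT_comp mF (measurableT_comp mT (measurable_funPT xi))).
Qed.

Let sqrU_measurable x : measurable_fun [set: Omega] (fun w => `|U x w| ^+ 2).
Proof.
apply: (@measurable_fun_random_map (fun y => `|x - y| ^+ 2)) => y.
have xy : `|x - z| @[z --> y] --> `|x - y|.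
  by apply: cvg_norm; apply: cvgB; [exact: cvg_cst|exact: cvg_id].
exact: (cvgM xy xy).
Qed.

Let ipU_measurable x h : measurable_fun [set: Omega] (fun w => ip (U x w) h).
Proof.
apply: (@measurable_fun_random_map (fun y => ip (x - y) h)) => y.
apply: (@continuous_comp _ _ _ (fun z => x - z) (ip^~ h : H -> R^o)).
  by apply: cvgB; [exact: cvg_cst|exact: cvg_id].
exact: (continuous_ipl ip_norm).
Qed.

(** The event is the zero set of the measurable function |U x|^2. *)
Let measurable_fix x : measurable [set w | Fix (T (xi w)) x].
Proof.
have -> : [set w | Fix (T (xi w)) x] =
    [set: Omega] `&` (fun w => `|U x w| ^+ 2) @^-1` [set 0].
  rewrite setTI; apply/seteqP; split => w /= => [Tx|].
    by rewrite /U Tx subrr normr0 expr0n.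
  by move=> /eqP; rewrite sqrf_eq0 normr_eq0 subr_eq0 => /eqP.
exact: sqrU_measurable.
Qed.

(** A nonnegative measurable function has integral 0 exactly when it vanishes almost everywhere. *)
Lemma common_fixpointsE x :
  common_fixpoints T xi x <-> (\int[P]_w (`|U x w| ^+ 2)%:E = 0)%E.
Proof.
have -> : (\int[P]_w (`|U x w| ^+ 2)%:E)%E =
    (\int[P]_w `|(`|U x w| ^+ 2)%:E|)%E.
  by apply: eq_integral => w _; rewrite gee0_abs// lee_fin.
rewrite (rwP eqP) -(rwP eqP).
have mE : measurable_fun [set: Omega] (fun w => (`|U x w| ^+ 2)%:E).
  exact/measurable_EFinP.
rewrite (ae_eq_integral_abs _ measurableT mE) /common_fixpoints /=.
have -> : (P [set w | Fix (T (xi w)) x] = 1)%E <->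
    (P (~` [set w | Fix (T (xi w)) x]) = 0)%E.
  rewrite probability_setC//; split => [->|]; first by rewrite subee.
  rewrite -(fineK (fin_num_measure P _ (measurable_fix x))) -EFinB => -[/eqP].
  by rewrite subr_eq0 => /eqP <-.
rewrite -(negligibleP _ (measurableC (measurable_fix x))).
rewrite /ae_eq /prop_near1 /almost_everywhere /=.
have -> // : ~` [set w | Fix (T (xi w)) x] =
    ~` [set w | [set: Omega] w -> (`|U x w| ^+ 2)%:E = cst 0 w :> \bar R].
congr (~` _); apply/seteqP; split => w /= => [Tx _|/(_ Logic.I)[]/eqP].
  by rewrite /U Tx subrr normr0 expr0n.
by rewrite sqrf_eq0 normr_eq0 subr_eq0 => /eqP.
Qed.

(** * Integrability of the random residuals *)

Lemma residualE x : residual T xi x = (\int[P]_w `|U x w| ^+ 2)%R.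
Proof. by rewrite /residual unlock. Qed.

Let integrableDZ (f g : Omega -> R) k :
  integrable f -> integrable g -> integrable (fun w => f w + k * g w).
Proof.
move=> fi gi.
exact: (integrableD measurableT fi (integrableZl measurableT k gi)).
Qed.

Let integrable_cst (r : R) : integrable (cst r).
Proof. exact: finite_measure_integrable_cst. Qed.

Let integrable_le (f g : Omega -> R) :
  measurable_fun [set: Omega] f -> (forall w, `|f w| <= g w) ->
  integrable g -> integrable f.
Proof.
move=> mf fg; apply: le_integrable => //; first exact/measurable_EFinP.
by move=> w _; rewrite /= lee_fin (le_trans (fg w))// ler_norm.
Qed.

(** Nonexpansiveness gives |U x|^2 <= 2 |x - c|^2 + 2 |U c|^2 for a common fixed point [c], and |U
    c|^2 has integral 0. *)
Let integrable_sqrU x : integrable (fun w => `|U x w| ^+ 2).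
Proof.
have [c cC] := C_neq0.
have ci : integrable (fun w => `|U c w| ^+ 2).
  apply/integrableP; split; first exact/measurable_EFinP.
  rewrite (_ : (\int[P]_w _)%E = 0%E) ?ltry//.
  move/common_fixpointsE : cC => <-.
  by apply: eq_integral => w _; rewrite gee0_abs// lee_fin.
apply: (integrable_le _ _
  (integrableDZ 2 (integrable_cst (2 * `|x - c| ^+ 2)) ci)).
  exact: sqrU_measurable.
move=> w /=; rewrite ger0_norm ?sqr_ge0//.
have := projector_res_lip ip_norm (@Ci_convex (xi w)) (T_projector (xi w)) x c.
rewrite -/(U x w) -/(U c w) => xc.
have : `|U x w| <= `|U x w - U c w| + `|U c w|.
  by rewrite -{1}(subrK (U c w) (U x w)) ler_normD.
have := normr_ge0 (U x w); have := normr_ge0 (U c w).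
have := sqr_ge0 (`|x - c| - `|U c w|); nra.
Qed.

Let ipU_le x h w : `|ip (U x w) h| <= (1 + 1 * `|U x w| ^+ 2) * `|h|.
Proof.
apply: le_trans (normr_ip_le ip_norm _ _) _; rewrite ler_wpM2r//.
by have := sqr_ge0 (`|U x w| - 1); have := sqr_ge0 `|U x w|; nra.
Qed.

Let integrable_ipU x h : integrable (fun w => ip (U x w) h).
Proof.
apply: (integrable_le _ (ipU_le x h)) => //.
have := integrableDZ `|h| (integrable_cst 0)
  (integrableDZ 1 (integrable_cst 1) (integrable_sqrU x)).
by apply: eq_integrable => // w _; rewrite /= add0r mulrC.
Qed.

Let RintegralDZ (f g : Omega -> R) k : integrable f -> integrable g ->
  (\int[P]_w (f w + k * g w) = \int[P]_w f w + k * \int[P]_w g w)%R.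
Proof.
move=> fi gi; rewrite RintegralD ?RintegralZl//.
exact: (integrableZl measurableT k gi).
Qed.

Let Rintegral_cstT (r : R) : (\int[P]_w cst r w = r)%R.
Proof. by rewrite Rintegral_cst// [X in fine X]probability_setT mulr1. Qed.

Let Rintegral_le (f g : Omega -> R) : integrable f -> integrable g ->
  (forall w, f w <= g w) -> (\int[P]_w f w <= \int[P]_w g w)%R.
Proof. by move=> fi gi fg; apply: le_Rintegral. Qed.

(* The gradient is the mean of [2 * (x - T (xi w) x)], taken in the weak sense
   since the values of [T] need not be separable. *)
Lemma exists_mean_residual : exists G : H -> H,
  forall x h, ip (G x) h = 2 * (\int[P]_w ip (U x w) h)%R.
Proof.
suff /choice[G GE] : forall x, exists g, forall h,
    2 * (\int[P]_w ip (U x w) h)%R = ip g h.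
  by exists G => x h; rewrite GE.
move=> x.
(* Integrating [ipU_le] bounds the functional by 2 M |h|. *)
pose M := (\int[P]_w (1 + 1 * `|U x w| ^+ 2))%R.
apply: (riesz_representation ip_norm (M := 2 * M)).
- move=> a b; rewrite -mulrDr; congr (2 * _).
  rewrite -RintegralD//; [|exact: integrable_ipU..].
  by apply: eq_Rintegral => w _; rewrite ipDr.
- move=> k a; rewrite mulrCA; congr (2 * _).
  rewrite -RintegralZl//; last exact: integrable_ipU.
  by apply: eq_Rintegral => w _; rewrite ipZr.
- move=> h; rewrite normrM ger0_norm// -mulrA ler_wpM2l//.
  apply: le_trans (le_normr_Rintegral _ (integrable_ipU x h)) _ => //.
  rewrite /M -RintegralZr//; last first.
    exact: (integrableDZ 1 (integrable_cst 1) (integrable_sqrU x)).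
  apply: le_Rintegral => //.
  - exact: (integrable_norm (integrable_ipU x h)).
  - have := integrableDZ `|h| (integrable_cst 0)
      (integrableDZ 1 (integrable_cst 1) (integrable_sqrU x)).
    by apply: eq_integrable => // w _; rewrite /= add0r mulrC.
Qed.

(** * Estimates for the residual through its mean gradient [G] *)

Context (G : H -> H).
Hypothesis GE : forall x h, ip (G x) h = 2 * (\int[P]_w ip (U x w) h)%R.

Lemma residual_ge x h : residual T xi x + ip (G x) h <= residual T xi (x + h).
Proof.
rewrite !residualE GE -RintegralDZ//.
apply: Rintegral_le; [exact: integrableDZ|exact: integrable_sqrU|].
move=> w.
have := projector_sqr_ge ip_norm (@Ci_convex (xi w)) (T_projector (xi w))
  x (x + h).
by rewrite [x + h]addrC addrK.
Qed.

Lemma residual_le x h :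
  residual T xi (x + h) <= residual T xi x + ip (G x) h + `|h| ^+ 2.
Proof.
rewrite !residualE GE -RintegralDZ//.
have iUh := integrableDZ 2 (integrable_sqrU x) (integrable_ipU x h).
(* As [P] has mass 1, the constant |h|^2 is its own integral. *)
rewrite -[X in _ <= _ + X]Rintegral_cstT.
rewrite -RintegralD//; last exact: integrable_cst.
apply: Rintegral_le; first exact: integrable_sqrU.
  exact: (integrableD measurableT iUh (integrable_cst _)).
move=> w.
have := projector_sqr_le ip_norm (T_projector (xi w)) x (x + h).
by rewrite [x + h]addrC addrK.
Qed.

Lemma mean_residual_lipschitz x y : `|G x - G y| <= 2 * `|x - y|.
Proof.
apply: (normr_le_ip ip_norm); first by rewrite mulr_ge0.
move=> h; rewrite ipDl ipNl !GE -mulrBr -mulrA ler_wpM2l//.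
have ix := integrable_ipU x h; have iy := integrable_ipU y h.
rewrite -RintegralB// -[leRHS]Rintegral_cstT.
apply: Rintegral_le; [|exact: integrable_cst|].
  exact: (integrableB measurableT ix iy).
move=> w; rewrite /cst -ipNl -ipDl.
apply: le_trans (ip_le ip_norm _ _) _; rewrite ler_wpM2r//.
exact: (projector_res_lip ip_norm (@Ci_convex (xi w)) (T_projector (xi w))).
Qed.

Lemma common_fixpoints_residual x :
  common_fixpoints T xi x <-> residual T xi x = 0.
Proof.
rewrite common_fixpointsE residualE /Rintegral; split => [->//|].
(* Since [fine] also sends infinite values to 0, finiteness of the integral is needed here. *)
move=> xE; rewrite -(@fineK _ (\int[P]_w _)%E) ?xE//.
exact/integrable_fin_num/integrable_sqrU.
Qed.

Lemma residual_ge0 x : 0 <= residual T xi x.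
Proof. by rewrite residualE; apply: Rintegral_ge0 => w _; exact: sqr_ge0. Qed.

(** Monotonicity gives <U x, x - c> >= |U x|^2 - |U x| |U c| pointwise. As [U c] vanishes only
    almost surely, the product is bounded by t |U x|^2 + |U c|^2 / (4 t); the last term integrates
    to 0, and [t] tends to 0. *)
Lemma residual_le_ip x c : common_fixpoints T xi c ->
  residual T xi x <= 2^-1 * ip (G x) (x - c).
Proof.
move=> /common_fixpoints_residual; rewrite residualE => c0.
rewrite GE mulKf// residualE -subr_le0.
apply: (@le0_of_quadratic _ _ (\int[P]_w `|U x w| ^+ 2)%R) => t /andP[t0 t1].
rewrite expr2 mulrA ler_pM2r// lerBlDl mulrC.
have ixc := integrable_ipU x (x - c).
have xt := integrableDZ t ixc (integrable_sqrU x).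
rewrite -RintegralDZ//.
rewrite -[leRHS]addr0 -[X in _ + X](mulr0 (4 * t)^-1) -c0 -RintegralDZ//.
apply: Rintegral_le => //; first exact: integrableDZ.
move=> w.
have Tcx := projector_mono ip_norm (@Ci_convex (xi w)) (T_projector (xi w)) x c.
have -> : x - c = U x w + (T (xi w) x - T (xi w) c) - U c w.
  rewrite /U addrA subrK opprB addrA; congr (_ - _).
  by rewrite subrK.
rewrite ipDr ipNr ipDr -ip_norm.
have := ip_le ip_norm (U x w) (U c w).
have : 0 <= (2 * t * `|U x w| - `|U c w|) ^+ 2 / (4 * t).
  by rewrite divr_ge0 ?sqr_ge0// mulr_ge0// ltW.
have -> : (2 * t * `|U x w| - `|U c w|) ^+ 2 / (4 * t) =
    t * `|U x w| ^+ 2 - `|U x w| * `|U c w| + (4 * t)^-1 * `|U c w| ^+ 2.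
  by field; rewrite gt_eqF.
move: Tcx; rewrite -/(U x w); lra.
Qed.

End random_projectors.

(** * Equivalence of regularity, gradient inequality and KL property *)

Theorem proposition4p2 (R : realType)
    (H : completeNormedModType R) (ip : {dot H for (@idfun R)})
    (ip_norm : induces_norm ip)
    (dO dI : measure_display)
    (Omega : measurableType dO) (I : measurableType dI)
    (P : probability Omega R)
    (mu : probability (borel H) R)
    (X0 : {RV P >-> borel H})
    (xi : {RV P >-> I}) (xi_ : nat -> {RV P >-> I})
    (T : I -> H -> H) (Ci : I -> set H)
    (X0_law : forall A : set (borel H), measurable A -> distribution P X0 A = mu A)
    (T_continuous : forall i, continuous (T i))
    (xi_copies : forall k, identically_distributed (xi_ k) xi)
    (X0_xi_independent : independent_sequence X0 xi_)
    (Phi_measurable :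
      measurable_fun [set: borel H * I] (fun z => T z.2 z.1 : borel H))
    (C_neq0 : common_fixpoints T xi !=set0)
    (Ci_neq0 : forall i, Ci i !=set0)
    (Ci_closed : forall i, closed (Ci i))
    (Ci_convex : forall i, convex_set (Ci i : set (convex_lmodType H)))
    (T_projector : forall i, is_projector (Ci i) (T i))
    (kappa : R) (kappa_gt0 : 0 < kappa) :
  let C := common_fixpoints T xi in
  let Res := residual T xi in
  let regularity := forall x : H, dist x C ^+ 2 <= kappa * Res x in
  let gradient_inequality :=
    forall x : H, Res x <= kappa / 4 * `|gradient ip Res x| ^+ 2 in
  [/\ regularity <-> gradient_inequality,
      gradient_inequality <->
        global_KL_with ip Res (fun s : R => Num.sqrt (kappa * s)) &
      gradient_inequality -> global_KL ip Res].
Proof.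
move=> C Res regularity gradient_inequality.
have kappa_ge0 := ltW kappa_gt0.
have [G GE] := exists_mean_residual ip_norm Phi_measurable C_neq0 Ci_convex
  T_projector.
have Res_ge : forall x h, Res x + ip (G x) h <= Res (x + h) :=
  residual_ge ip_norm Phi_measurable C_neq0 Ci_convex T_projector GE.
have Res_le : forall x h, Res (x + h) <= Res x + ip (G x) h + `|h| ^+ 2 :=
  residual_le ip_norm Phi_measurable C_neq0 Ci_convex T_projector GE.
have Res_ge0 x : 0 <= Res x by exact: residual_ge0.
have gradE : gradient ip Res = G.
  by apply/funext => x; exact: (gradient_sandwich ip_norm Res_ge Res_le).
have G_continuous : continuous G.
  apply: (@lipschitz_continuous _ _ _ _ 2).
  exact: (mean_residual_lipschitz ip_norm Phi_measurable C_neq0 Ci_convex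
    T_projector GE).
have CE : C = [set y | Res y = 0].
  have CP x : C x <-> Res x = 0.
    exact: (common_fixpoints_residual ip_norm Phi_measurable C_neq0 Ci_convex
      T_projector).
  by apply/seteqP; split => x /= /CP.
have [c Cc] := C_neq0.
have Resc : Res c = 0 by move: Cc; rewrite -/C CE.
have argminE x : argmin Res x <-> Res x = 0.
  split=> [xmin|x0 y]; last by rewrite x0.
  by apply/eqP; rewrite eq_le Res_ge0 andbT -Resc.
have regularity_gradient : regularity -> gradient_inequality.
  move=> reg x; rewrite gradE.
  (* Take the infimum over [C] in 2 Res x <= |G x| |x - a|; dividing by |G x| requires the case 0
     apart. *)
  have ResG : 2 * Res x <= `|G x| * dist x C.
    have [G0|G0] := eqVneq `|G x| 0.
      have := residual_le_ip ip_norm Phi_measurable C_neq0 Ci_convex T_projector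
        GE x Cc.
      by have := ip_le ip_norm (G x) (x - c); rewrite -/Res G0 !mul0r; lra.
    have {}G0 : 0 < `|G x| by rewrite lt_def G0 /=.
    rewrite -ler_pdivrMl//; apply: le_dist; first by exists c.
    move=> a Ca; rewrite ler_pdivrMl//.
    have := residual_le_ip ip_norm Phi_measurable C_neq0 Ci_convex T_projector
      GE x Ca.
    by have := ip_le ip_norm (G x) (x - a); rewrite -/Res; lra.
  have [->|Rx0] := eqVneq (Res x) 0; first by rewrite mulr_ge0 ?divr_ge0.
  have {}Rx0 : 0 < Res x by rewrite lt_def Rx0 Res_ge0.
  (* Square [ResG] and insert regularity; one factor [Res x] then cancels. *)
  have ResG2 : (2 * Res x) ^+ 2 <= `|G x| ^+ 2 * (kappa * Res x).
    apply: (@le_trans _ _ ((`|G x| * dist x C) ^+ 2)).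
      by rewrite ler_sqr ?nnegrE ?mulr_ge0 ?dist_ge0.
    by rewrite exprMn ler_wpM2l ?sqr_ge0//; exact: reg.
  by rewrite -(ler_pM2r Rx0); lra.
have gradient_regularity : gradient_inequality -> regularity.
  move=> gi x; rewrite CE.
  apply: (error_bound ip_norm Res_ge0 Res_le G_continuous kappa_gt0) => y.
  by rewrite -gradE.
have slopeE x : 0 < Res x ->
    (1 <= derive1 ((fun s : R => Num.sqrt (kappa * s)) : R -> R^o) (Res x)
      * `|gradient ip Res x|) =
    (Res x <= kappa / 4 * `|gradient ip Res x| ^+ 2).
  move=> Rx0; rewrite (derive1_sqrtM kappa_gt0 Rx0).2.
  rewrite mulrAC ler_pdivlMr ?mulr_gt0 ?sqrtr_gt0// mul1r.
  rewrite -ler_sqr ?nnegrE ?mulr_ge0 ?sqrtr_ge0// !exprMn !sqr_sqrtr//.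
  by apply/idP/idP; lra.
have gradient_KL : gradient_inequality ->
    global_KL_with ip Res (fun s : R => Num.sqrt (kappa * s)).
  move=> gi; split.
  - exact: (convex_function_sandwich ip_norm Res_ge).
  - split; last by rewrite gradE.
    by move=> x; case: (is_gradient_sandwich ip_norm Res_ge Res_le x).
  - split; last by exists c; apply/argminE.
    apply/eqP; rewrite eq_le; apply/andP; split.
      rewrite -[leRHS]Resc; apply: ge_inf; last by exists c.
      by exists 0 => _ [x _ <-].
    by apply: lb_le_inf; [exists (Res c), c|move=> _ [x _ <-]].
  - exact: desingularizing_sqrt.
  - move=> x /argminE/eqP Rx0; rewrite slopeE//.
    by rewrite lt_def Rx0 Res_ge0.
split=> //; last first.
  by move=> gi; exists (fun s => Num.sqrt (kappa * s)); exact: gradient_KL.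
split=> // -[_ _ _ _ KL] x.
(* The KL inequality speaks only of points outside [argmin Res]; on it the bound is trivial. *)
have [->|Rx0] := eqVneq (Res x) 0; first by rewrite mulr_ge0 ?divr_ge0.
rewrite -slopeE ?lt_def ?Rx0 ?Res_ge0//.
by apply: KL => /argminE/eqP; rewrite (negbTE Rx0).
Qed.
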